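(* Let $f_i,g_i:[0,1]\to[0,1]$ be defined by $f_i(x)=\rho_i x+t_i$ and $g_i(x)=\beta_i x+t_i$, where $\rho_i\in(0,1)$, $\beta_i\in(0,\rho_i]$ and $t_i\in[0,1)$ for $i=1,2$. Suppose that $f=(f_1,f_2)$ satisfies $\max\{f_1(0),f_1(1)\}\le\max\{f_2(0),f_2(1)\}$ and $f_1(0,1)\cap f_2(0,1)=\emptyset$, and let $g=(g_1,g_2)$. If $(p,q)$ is a pair of probability vectors $p=(p_1,p_2)=(p_1,1-p_1)$ and $q=(q_1,q_2)=(q_1,1-q_1)$ such that $p_1\le q_1$, then $$W_1\left(\mu^{(f,p)},\mu^{(g,q)}\right)=\frac{\sum_{i}q_it_i}{1-\sum_i q_i\beta_i}-\frac{\sum_i p_it_i}{1-\sum_i p_i\rho_i}.$$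
   Context: For a pair $f=(f_1,f_2)$ of contractions of $[0,1]$ and a probability vector $p=(p_1,p_2)$, the stationary probability measure $\mu^{(f,p)}$ is the unique Borel probability measure $\mu$ on $[0,1]$ with $\mu(A)=\sum_{i=1}^2 p_i\,\mu(f_i^{-1}(A))$ for all Borel sets $A$. The first Wasserstein distance is $W_1(\mu,\nu)=\inf\{\mathbb{E}|X-Y|:\mathrm{law}(X)=\mu,\ \mathrm{law}(Y)=\nu\}$. Sums over $i$ run over $i=1,2$.
   Formalization: The printed right-hand side has the wrong sign (it is ≤ 0, e.g. −1/4 for ρ=β=(1/2,1/2), t=(0,1/2), p=(1/2,1/2), q=(3/4,1/4)); the theorem proved has the two terms swapped: Σp_i t_i/(1−Σp_i ρ_i) − Σq_i t_i/(1−Σq_i β_i). *)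

(* Defs.v *)
From HB Require Import structures.
From mathcomp Require Import all_boot all_order all_algebra.
From mathcomp Require Import all_classical all_reals all_analysis.

Set Implicit Arguments.
Unset Strict Implicit.
Unset Printing Implicit Defensive.

Import Order.TTheory GRing.Theory Num.Theory.
Import numFieldNormedType.Exports.

Local Open Scope classical_set_scope.
Local Open Scope ring_scope.

(* Pairs indexed by i = 1, 2 are families over 'I_2, index 1 being the
   ordinal 0 and index 2 the ordinal 1. *)

Definition affine_pair (R : realType) (a t : 'I_2 -> R) : 'I_2 -> R -> R :=
  fun i x => a i * x + t i.

Definition prob_vector (R : realType) (p : 'I_2 -> R) : Prop :=
  (forall i, 0 <= p i) /\ \sum_(i < 2) p i = 1.

(* Borel probability measures on [0, 1] are represented by Borel probability
   measures on R giving mass 1 to [0, 1]. Stationarity only involves Borel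
   subsets of [0, 1] and preimages taken inside [0, 1]. *)
Definition is_stationary (R : realType) (f : 'I_2 -> R -> R) (p : 'I_2 -> R)
    (mu : probability (measurableTypeR R) R) : Prop :=
  mu (`[0, 1]%classic : set R) = 1%E /\
  forall A : set (measurableTypeR R), measurable A -> A `<=` (`[0, 1]%classic : set R) ->
    mu A = (\sum_(i < 2) (p i)%:E * mu ((`[0%R, 1%R]%classic : set R) `&` f i @^-1` A))%E.

Definition has_law (R : realType) (d : measure_display) (T : measurableType d)
    (P : probability T R) (X : {RV P >-> R})
    (mu : probability (measurableTypeR R) R) : Prop :=
  forall A : set (measurableTypeR R), measurable A -> distribution P X A = mu A.

(* The infimum runs over all probability spaces carrying both variables. *)
Definition W1 (R : realType) (mu nu : probability (measurableTypeR R) R) :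
    \bar R :=
  ereal_inf [set e : \bar R |
    exists (d : measure_display) (T : measurableType d) (P : probability T R)
      (X Y : {RV P >-> R}),
      [/\ has_law X mu, has_law Y nu &
          e = ('E_P[fun w => `|X w - Y w|%R])%E]].

(* Main.v *)
Require Import Defs.
From HB Require Import structures.
From mathcomp Require Import all_boot all_order all_algebra.
From mathcomp Require Import all_classical all_reals all_analysis.
From mathcomp Require Import measurable_realfun.
From mathcomp Require Import ring lra.

Set Implicit Arguments.
Unset Strict Implicit.
Unset Printing Implicit Defensive.

Import Order.TTheory GRing.Theory Num.Theory.
Import numFieldNormedType.Exports.

Local Open Scope classical_set_scope.
Local Open Scope ring_scope.

(** The two sides of the equality are compared through the elementary identity
    [|x - y| = x - y + 2 (y - x)^+].  For every coupling [(X, Y)] of [mu] and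
    [nu] it gives
      [E |X - Y| = m(mu) - m(nu) + 2 E (Y - X)^+],
    where [m] is the mean ([expectation_dist]).  Hence the distance is at least
    [m(mu) - m(nu)], and it equals this number as soon as couplings exist whose
    order gap [E (Y - X)^+] is arbitrarily small.  The mean of a stationary
    measure is computed by integrating the stationarity equation
    ([stationary_mean]).

    Such couplings come from iterating a joint step of the two systems.  Since
    [p 0 <= q 0], the vectors [p] and [q] are the marginals of the weights
    [p 0], [q 0 - p 0], [q 1] on the index pairs [(0, 0)], [(1, 0)], [(1, 1)].
    Applying the pair of maps [(f_i, g_j)] to [(X, Y)], with [(i, j)] drawn with
    these weights, yields a coupling of [mu] and [nu] again, by stationarity.
    When [i = j],
      [g_i y - f_i x = beta_i y - rho_i x <= rho_i (y - x)],
    because [beta_i <= rho_i] and [y >= 0]; for the pair [(1, 0)],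
      [g_0 y <= rho_0 + t_0 <= t_1 <= f_1 x],
    because the image of [f_0] lies to the left of that of [f_1].  The order gap
    is therefore multiplied by at most [p_0 rho_0 + p_1 rho_1 < 1]
    ([coupling_step]).  Starting from the product coupling, the order gap tends
    to zero geometrically.  An order-preserving stationary coupling is never
    needed: the infimum defining the distance absorbs the small gap. *)

(** * Mixtures of image measures *)

Section mixture.
Context d1 d2 (T1 : measurableType d1) (T2 : measurableType d2) (R : realType).
Variables (P : {measure set T1 -> \bar R}) (n : nat).
Variables (w : 'I_n -> {nonneg R}) (h : 'I_n -> T1 -> T2).
Hypothesis mh : forall i, measurable_fun setT (h i).

Let image_measure (i : 'I_n) : {measure set T2 -> \bar R} :=
  measure_function_pushforward__canonical__measure_function_Measure P (mh i).

(** The terms of [mix], as a sequence of measures indexed by all natural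
    numbers; the indices [k >= n] are irrelevant and get the zero measure. *)
Definition mix_term (k : nat) : {measure set T2 -> \bar R} :=
  if insub k is Some i then mscale (w i) (image_measure i) else mzero.

(** The mixture [\sum_i w i * (h i)_# P] of the image measures of [P]. *)
Definition mix : set T2 -> \bar R := msum mix_term n.

HB.instance Definition _ := Measure.on mix.

Lemma mixE (A : set T2) :
  mix A = (\sum_(i < n) (w i)%:num%:E * P (h i @^-1` A))%E.
Proof.
by apply: eq_bigr => i _; rewrite /mix_term valK.
Qed.

Lemma ge0_integral_mix (phi : T2 -> \bar R) :
  measurable_fun setT phi -> (forall y, (0 <= phi y)%E) ->
  (\int[mix]_y phi y = \sum_(i < n) (w i)%:num%:E * \int[P]_x phi (h i x))%E.
Proof.
move=> mphi phi0; rewrite /mix ge0_integral_measure_sum//.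
apply: eq_bigr => i _; rewrite /mix_term valK ge0_integral_mscale//.
by rewrite ge0_integral_pushforward.
Qed.

End mixture.

(** A measure that agrees on events with a mixture of image measures
    integrates nonnegative functions accordingly. *)
Lemma ge0_integral_mixture d1 d2 (T1 : measurableType d1)
    (T2 : measurableType d2) (R : realType) (P : {measure set T1 -> \bar R})
    (Q : {measure set T2 -> \bar R}) n (w : 'I_n -> R) (h : 'I_n -> T1 -> T2) :
  (forall i, 0 <= w i) -> (forall i, measurable_fun setT (h i)) ->
  (forall A, measurable A ->
     Q A = (\sum_(i < n) (w i)%:E * P (h i @^-1` A))%E) ->
  forall phi : T2 -> \bar R,
  measurable_fun setT phi -> (forall y, (0 <= phi y)%E) ->
  (\int[Q]_y phi y = \sum_(i < n) (w i)%:E * \int[P]_x phi (h i x))%E.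
Proof.
move=> w0 mh QE phi mphi phi0.
pose w' i : {nonneg R} := NngNum (w0 i).
rewrite (eq_measure_integral (mix P w' mh)) ?ge0_integral_mix// => A mA _.
by rewrite QE//= mixE.
Qed.

(** A mixture of images of a probability measure with weights of sum [1] is a
    probability measure. *)
Lemma exists_mixture d1 d2 (T1 : measurableType d1)
    (T2 : measurableType d2) (R : realType) (P : probability T1 R)
    n (w : 'I_n -> R) (h : 'I_n -> T1 -> T2) :
  (forall i, 0 <= w i) -> \sum_(i < n) w i = 1 ->
  (forall i, measurable_fun setT (h i)) ->
  exists Q : probability T2 R, forall A,
    Q A = (\sum_(i < n) (w i)%:E * P (h i @^-1` A))%E.
Proof.
move=> w0 w1 mh.
pose w' i : {nonneg R} := NngNum (w0 i).
have mixT : mix P w' mh setT = 1%E.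
  rewrite mixE; transitivity (\sum_(i < n) (w i)%:E)%E; last first.
    by rewrite sumEFin w1.
  apply: eq_bigr => i _; rewrite preimage_setT.
  by rewrite [X in (_ * X)%E](probability_setT P) mule1.
pose Q : probability T2 R := HB.pack (mix P w' mh)
  (Measure_isProbability.Build _ _ _ (mix P w' mh) mixT).
by exists Q => A; rewrite -[LHS]/(mix P w' mh A) mixE.
Qed.

(** * Two-point weights *)

Lemma sum_ord2 (V : nmodType) (F : 'I_2 -> V) : \sum_(i < 2) F i = F 0 + F 1.
Proof.
by rewrite big_ord_recl big_ord1; congr (_ + F _); exact: val_inj.
Qed.

Lemma convex_comb_lt1 (R : realType) (w0 w1 x y : R) :
  0 <= w0 -> 0 <= w1 -> w0 + w1 = 1 -> x < 1 -> y < 1 -> w0 * x + w1 * y < 1.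
Proof.
move=> w00 w10 w01 x1 y1.
apply: (@le_lt_trans _ _ (Num.max x y)); last by rewrite gt_max x1 y1.
rewrite -[leRHS]mul1r -w01 mulrDl lerD// ler_wpM2l// le_max lexx ?orbT//.
Qed.

(** * Stationary measures of affine pairs *)

Lemma measurable_affine_pair (R : realType) (a t : 'I_2 -> R) i :
  measurable_fun [set: measurableTypeR R]
    (affine_pair a t i : measurableTypeR R -> measurableTypeR R).
Proof. by apply: measurable_funD => //; apply: measurable_funM. Qed.

Section unit_interval.
Context (R : realType) (mu : probability (measurableTypeR R) R).
Let U : set (measurableTypeR R) := `[0, 1]%classic.
Hypothesis mu1 : mu U = 1%E.

Let mU : measurable U. Proof. exact: measurable_itv. Qed.

Lemma measure_setI_itv01 (A : set (measurableTypeR R)) :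
  measurable A -> mu (U `&` A) = mu A.
Proof.
move=> mA.
have m0 : mu (A `&` ~` U) = 0%E.
  apply/eqP; rewrite -measure_le0 -[leRHS](subee (x := 1%E))// -{2}mu1.
  rewrite -probability_setC//; apply: le_measure; rewrite ?inE//.
  - by apply: measurableI => //; exact: measurableC.
  - exact: measurableC.
by rewrite [RHS](measureDI mu mA mU) setDE [X in (X + _)%E]m0 add0e setIC.
Qed.

Lemma ae_itv01 : {ae mu, forall x, 0 <= (x : R) <= 1}.
Proof.
exists (~` U); split; first exact: measurableC.
- by rewrite probability_setC// mu1 subee.
- by move=> x; apply: contra_not; rewrite /U /= in_itv.
Qed.

Lemma integral_norm_le1 : (\int[mu]_x `|x : R|%:E <= 1)%E.
Proof.
have mabs : measurable_fun [set: measurableTypeR R]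
    (fun x : measurableTypeR R => `|x : R|%:E).
  by apply/measurable_EFinP; exact: normr_measurable.
apply: (@le_trans _ _ (\int[mu]_(x in setT) (cst 1%E x))%E).
  apply: ae_ge0_le_integral => //.
  have := ae_itv01; apply: (@filterS _ _ (ae_filter_ringOfSetsType mu)).
  by move=> x /andP[x0 x1] _; rewrite lee_fin ger0_norm.
by rewrite integral_cst// mul1e [X in (X <= _)%E](probability_setT mu).
Qed.

End unit_interval.

Section stationary.
Context (R : realType) (a t p : 'I_2 -> R).
Variable mu : probability (measurableTypeR R) R.
Hypotheses (p_prob : prob_vector p) (a_itv : forall i, 0 <= a i < 1)
  (t_ge0 : forall i, 0 <= t i)
  (sub01 : forall i, affine_pair a t i @` `[0, 1]%classic `<=` `[0, 1]%classic)
  (mu_stat : is_stationary (affine_pair a t) p mu).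

(** Stationarity extends from Borel subsets of the unit interval to all Borel
    sets, because both sides only see the trace on the unit interval. *)
Lemma stationaryE (A : set (measurableTypeR R)) : measurable A ->
  mu A = (\sum_(i < 2) (p i)%:E * mu (affine_pair a t i @^-1` A))%E.
Proof.
move=> mA; have [mu1 muE] := mu_stat.
rewrite -(measure_setI_itv01 mu1 mA) muE; first last.
- exact: subIsetl.
- by apply: measurableI => //; exact: measurable_itv.
apply: eq_bigr => i _; congr (_ * _)%E.
have mfA : measurable (affine_pair a t i @^-1` A : set (measurableTypeR R)).
  by rewrite -[X in measurable X]setTI; exact: measurable_affine_pair.
rewrite -(measure_setI_itv01 mu1 mfA); congr (mu _).
apply/seteqP; split=> x [x01 /=]; first by case.
by move=> Afx; split=> //; split=> //; apply: (sub01 (i := i)); exists x.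
Qed.

(** The mean [m] solves [m = \sum_i p i * (a i * m + t i)].  It is written as
    the integral of [|x|], which agrees with [x] almost everywhere, so that only
    integrals of nonnegative functions occur. *)
Lemma stationary_mean :
  (\int[mu]_x `|x : R|%:E =
   ((\sum_(i < 2) p i * t i) / (1 - \sum_(i < 2) p i * a i))%:E)%E.
Proof.
have [mu1 _] := mu_stat; have [p0 p1] := p_prob.
have mabs : measurable_fun [set: measurableTypeR R]
    (fun x : measurableTypeR R => `|x : R|%:E).
  by apply/measurable_EFinP; exact: normr_measurable.
have := integral_norm_le1 mu1.
have : (0 <= \int[mu]_x `|x : R|%:E)%E by apply: integral_ge0.
have := ge0_integral_mixture p0 (@measurable_affine_pair R a t) stationaryE
  mabs (fun y => normr_ge0 (y : R)).
have intE i : (\int[mu]_x `|affine_pair a t i x : R|%:E =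
    (a i)%:E * \int[mu]_x `|x : R|%:E + (t i)%:E)%E.
  have /andP[ai0 _] := a_itv i.
  rewrite -ge0_integralZl//.
  rewrite -[X in (_ = _ + X)%E]mule1.
  rewrite -[X in (_ = _ + _ * X)%E](probability_setT mu).
  rewrite -integral_cst// -ge0_integralD//; first last.
  - by move=> x _; rewrite lee_fin.
  - exact: measurable_funeM.
  - by move=> x _; rewrite mule_ge0// lee_fin.
  apply: ge0_ae_eq_integral => //.
  - apply/measurable_EFinP; apply: measurableT_comp => //.
    exact: measurable_affine_pair.
  - apply: emeasurable_funD => //; exact: measurable_funeM.
  - by move=> x _; rewrite adde_ge0// ?mule_ge0// lee_fin.
  - have := ae_itv01 mu1; apply: (@filterS _ _ (ae_filter_ringOfSetsType mu)).
    move=> x /andP[x0 x1] _.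
    by rewrite /affine_pair !ger0_norm// ?addr_ge0// mulr_ge0.
under eq_bigr do rewrite intE.
case: (\int[mu]_x `|x : R|%:E)%E => [m||//]; last first.
  by move=> _ _; rewrite leye_eq.
rewrite sum_ord2 => /(congr1 fine) /= mE _ _; congr EFin.
move: p1; rewrite !sum_ord2 => p1.
have d0 : 1 - (p 0 * a 0 + p 1 * a 1) != 0.
  by rewrite subr_eq0 gt_eqF// convex_comb_lt1//;
    [case/andP: (a_itv 0)|case/andP: (a_itv 1)].
apply: (mulIf d0); rewrite divfK//; lra.
Qed.

End stationary.

(** * Couplings and their order gap *)

Section law.
Context d (T : measurableType d) (R : realType) (P : probability T R).
Context (mu : probability (measurableTypeR R) R) (X : {RV P >-> R}).
Hypothesis lawX : has_law X mu.

Lemma ge0_integral_law (phi : measurableTypeR R -> \bar R) :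
  measurable_fun setT phi -> (forall x, (0 <= phi x)%E) ->
  (\int[P]_w phi (X w) = \int[mu]_x phi x)%E.
Proof.
move=> mphi phi0.
(* [R] with its default Borel structure and [measurableTypeR R] have the same
   measurable sets but different displays; [X] is reread as a function into the
   latter, on which [mu] lives. *)
have mX : measurable_fun [set: T] (X : T -> measurableTypeR R).
  exact: (measurable_funP X).
transitivity (\int[pushforward P (X : T -> measurableTypeR R)]_x phi x)%E.
  by rewrite ge0_integral_pushforward.
pose m :=
  measure_function_pushforward__canonical__measure_function_Measure P mX.
by rewrite (@eq_measure_integral _ _ _ setT mu m)// => A mA _; exact: lawX.
Qed.

Lemma law_ae_itv01 : mu (`[0, 1]%classic : set R) = 1%E ->
  {ae P, forall w, 0 <= X w <= 1}.
Proof.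
move=> mu1; exists (X @^-1` ~` `[0, 1]%classic); split.
- rewrite -[X in measurable X]setTI; apply: measurable_funP => //.
  by apply: measurableC; exact: measurable_itv.
- have mC : measurable (~` `[0, 1]%classic : set (measurableTypeR R)).
    by apply: measurableC; exact: measurable_itv.
  rewrite -[LHS]/(distribution P X (~` `[0, 1]%classic)) lawX//.
  by rewrite probability_setC ?mu1 ?subee//; exact: measurable_itv.
- by move=> w; apply: contra_not; rewrite /= in_itv.
Qed.

End law.

(** The pointwise identity [|y| + |x - y| = |x| + 2 (y - x)^+] on the unit
    square, integrated; all terms are nonnegative, so that no integrability is
    needed. *)
Lemma expectation_dist d (T : measurableType d) (R : realType)
    (P : probability T R) (mu nu : probability (measurableTypeR R) R)
    (X Y : {RV P >-> R}) :
  has_law X mu -> has_law Y nu ->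
  mu (`[0, 1]%classic : set R) = 1%E -> nu (`[0, 1]%classic : set R) = 1%E ->
  (\int[nu]_y `|y : R|%:E + 'E_P[fun w => `|X w - Y w|%R] =
   \int[mu]_x `|x : R|%:E + 2%:E * \int[P]_w (Num.max 0 (Y w - X w))%:E)%E.
Proof.
move=> lX lY mu1 nu1; rewrite unlock.
have mabs : measurable_fun [set: measurableTypeR R]
    (fun x : measurableTypeR R => `|x : R|%:E).
  by apply/measurable_EFinP; exact: normr_measurable.
have mX : measurable_fun [set: T] X by exact: measurable_funP.
have mY : measurable_fun [set: T] Y by exact: measurable_funP.
rewrite -(ge0_integral_law lX)// -(ge0_integral_law lY)//.
have mnX : measurable_fun [set: T] (fun w => `|X w|%:E).
  by apply/measurable_EFinP; apply: measurableT_comp.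
have mnY : measurable_fun [set: T] (fun w => `|Y w|%:E).
  by apply/measurable_EFinP; apply: measurableT_comp.
have mnXY : measurable_fun [set: T] (fun w => `|X w - Y w|%:E).
  apply/measurable_EFinP; apply: measurableT_comp => //.
  exact: measurable_funB.
have mg : measurable_fun [set: T] (fun w => (Num.max 0 (Y w - X w))%:E).
  apply/measurable_EFinP; apply: measurable_maxr => //.
  exact: measurable_funB.
have g0 w : (0 <= (Num.max 0 (Y w - X w))%:E)%E by rewrite lee_fin le_max lexx.
rewrite -ge0_integralZl// -!ge0_integralD//; first last.
- exact: measurable_funeM.
- by move=> w _; rewrite mule_ge0.
apply: ge0_ae_eq_integral => //.
- exact: emeasurable_funD.
- by apply: emeasurable_funD => //; exact: measurable_funeM.
- by move=> w _; rewrite adde_ge0.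
- by move=> w _; rewrite adde_ge0// mule_ge0.
have := law_ae_itv01 lY nu1; have := law_ae_itv01 lX mu1.
apply: (@filterS2 _ _ (ae_filter_ringOfSetsType P)) => w.
move=> /andP[X0 _] /andP[Y0 _] _.
rewrite -EFinM -!EFinD (ger0_norm X0) (ger0_norm Y0); congr EFin.
by case: (ger0P (X w - Y w)); case: (leP 0 (Y w - X w)); lra.
Qed.

Section coupling.
Context (R : realType).
Notation V := (measurableTypeR R).
Implicit Types (mu nu : probability V R) (pi : probability (V * V)%type R).

(** Couplings given as joint laws on the plane, by their two marginals. *)
Definition is_coupling mu nu pi : Prop :=
  forall A : set V, measurable A ->
    pi (fst @^-1` A) = mu A /\ pi (snd @^-1` A) = nu A.

(** The mean of [(y - x)^+], which measures how far a coupling is from being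
    supported on the half-plane [y <= x]. *)
Definition order_gap pi : \bar R :=
  (\int[pi]_z (Num.max 0 ((z.2 : R) - (z.1 : R)))%:E)%E.

Lemma measurable_order_gap :
  measurable_fun [set: (V * V)%type]
    (fun z => (Num.max 0 ((z.2 : R) - (z.1 : R)))%:E).
Proof.
apply/measurable_EFinP; apply: measurable_maxr => //.
by apply: measurable_funB; [exact: measurable_snd|exact: measurable_fst].
Qed.

Lemma product_is_coupling mu nu : is_coupling mu nu (mu \x nu)%E.
Proof.
move=> A mA; split.
- have -> : fst @^-1` A = A `*` [set: V].
    by apply/seteqP; split=> [z /= Az|z []].
  transitivity (mu A * nu setT)%E; first exact: product_measure1E.
  by rewrite [X in (_ * X)%E](probability_setT nu) mule1.
- have -> : snd @^-1` A = [set: V] `*` A.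
    by apply/seteqP; split=> [z /= Az|z []].
  transitivity (mu setT * nu A)%E; first exact: product_measure1E.
  by rewrite [X in (X * _)%E](probability_setT mu) mul1e.
Qed.

(** The coordinates of the plane realise a coupling by random variables. *)
Lemma coupling_rv mu nu pi : is_coupling mu nu pi ->
  exists X Y : {RV pi >-> R},
    [/\ has_law X mu, has_law Y nu, X = fst :> (V * V -> R) &
        Y = snd :> (V * V -> R)].
Proof.
move=> cpl.
have mfst : measurable_fun [set: (V * V)%type] (fst : V * V -> R).
  by move=> _ B mB; exact: measurable_fst.
have msnd : measurable_fun [set: (V * V)%type] (snd : V * V -> R).
  by move=> _ B mB; exact: measurable_snd.
pose X : {RV pi >-> R} :=
  HB.pack (fst : V * V -> R) (isMeasurableFun.Build _ _ _ _ _ mfst).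
pose Y : {RV pi >-> R} :=
  HB.pack (snd : V * V -> R) (isMeasurableFun.Build _ _ _ _ _ msnd).
by exists X, Y; split=> // A mA; [exact: (cpl A mA).1|exact: (cpl A mA).2].
Qed.

(** Every coupling bounds the Wasserstein distance through its order gap. *)
Lemma W1_le_coupling mu nu pi :
  is_coupling mu nu pi ->
  mu (`[0, 1]%classic : set R) = 1%E -> nu (`[0, 1]%classic : set R) = 1%E ->
  (\int[nu]_y `|y : R|%:E + W1 mu nu <=
   \int[mu]_x `|x : R|%:E + 2%:E * order_gap pi)%E.
Proof.
move=> cpl mu1 nu1; have [X [Y [lX lY XE YE]]] := coupling_rv cpl.
have := expectation_dist lX lY mu1 nu1.
have -> : (\int[pi]_w (Num.max 0 (Y w - X w))%:E)%E = order_gap pi.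
  by rewrite XE YE.
move=> <-; rewrite leeD2l//; apply: ereal_inf_lbound.
by exists _, _, pi, X, Y.
Qed.

(** The difference of the means is a lower bound for the distance. *)
Lemma W1_ge mu nu (a b : R) :
  mu (`[0, 1]%classic : set R) = 1%E -> nu (`[0, 1]%classic : set R) = 1%E ->
  (\int[mu]_x `|x : R|%:E = a%:E)%E -> (\int[nu]_y `|y : R|%:E = b%:E)%E ->
  ((a - b)%:E <= W1 mu nu)%E.
Proof.
move=> mu1 nu1 muE nuE.
apply: le_ereal_inf_tmp => _ [d [T [P [X [Y [lX lY ->]]]]]].
have := expectation_dist lX lY mu1 nu1; rewrite muE nuE => dE.
rewrite EFinB leeBlDl// dE leeDl// mule_ge0// integral_ge0// => w _.
by rewrite lee_fin le_max lexx.
Qed.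

End coupling.

(** * Contraction of the order gap *)

Section contraction.
Context (R : realType) (rho beta t p q : 'I_2 -> R).
Notation V := (measurableTypeR R).
Variables mu nu : probability V R.
Hypotheses (rho_itv : forall i, 0 < rho i < 1)
  (beta_le : forall i, 0 < beta i <= rho i)
  (f01 : forall i, affine_pair rho t i @` `[0, 1]%classic `<=` `[0, 1]%classic)
  (g01 : forall i, affine_pair beta t i @` `[0, 1]%classic `<=` `[0, 1]%classic)
  (separated : rho 0 + t 0 <= t 1)
  (p_prob : prob_vector p) (q_prob : prob_vector q) (pq : p 0 <= q 0)
  (mu_stat : is_stationary (affine_pair rho t) p mu)
  (nu_stat : is_stationary (affine_pair beta t) q nu).

(** The pairs of indices [(0, 0)], [(1, 0)] and [(1, 1)] of the maps of the two
    systems, with weights [p 0], [q 0 - p 0] and [q 1], form the coupling of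
    [p] and [q] in which the second index never exceeds the first one. *)
Let idx1 (k : 'I_3) : 'I_2 := if val k is 0%N then 0 else 1.
Let idx2 (k : 'I_3) : 'I_2 := if val k is 2%N then 1 else 0.
Let wt (k : 'I_3) : R :=
  match val k with 0%N => p 0 | 1%N => q 0 - p 0 | _ => q 1 end.
Let pair_map (k : 'I_3) (z : V * V) : V * V :=
  (affine_pair rho t (idx1 k) z.1, affine_pair beta t (idx2 k) z.2).

Let sum_ord3 (W : nmodType) (F : 'I_3 -> W) :
  \sum_(k < 3) F k =
  F ord0 + (F (lift ord0 ord0) + F (lift ord0 (lift ord0 ord0))).
Proof. by rewrite !big_ord_recl big_ord0 addr0. Qed.

Let p1E : p 1 = 1 - p 0.
Proof. by have [_] := p_prob; rewrite sum_ord2; lra. Qed.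

Let q1E : q 1 = 1 - q 0.
Proof. by have [_] := q_prob; rewrite sum_ord2; lra. Qed.

Let wt_ge0 k : 0 <= wt k.
Proof.
have [p0 _] := p_prob; have [q0 _] := q_prob.
by rewrite /wt; case: (val k) => [//|[|_]//]; rewrite subr_ge0.
Qed.

Let wt_sum : \sum_(k < 3) wt k = 1.
Proof. by rewrite sum_ord3 /wt /= q1E; lra. Qed.

Let measurable_pair_map k : measurable_fun [set: (V * V)%type] (pair_map k).
Proof.
apply/measurable_fun_pair; apply: measurableT_comp => //;
  exact: measurable_affine_pair.
Qed.

(** Off the diagonal only the pair [(1, 0)] occurs, for which the left-hand side
    vanishes since the two images are separated. *)
Let affine_le (i j : 'I_2) (x y : R) : (i == j) || (j == 0) && (i == 1) ->
  0 <= x <= 1 -> 0 <= y <= 1 ->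
  Num.max 0 (affine_pair beta t j y - affine_pair rho t i x) <=
  rho i * Num.max 0 (y - x).
Proof.
move=> ij /andP[x0 x1] /andP[y0 y1]; rewrite /affine_pair ge_max.
have /andP[r0 _] := rho_itv i; have /andP[b0 br] := beta_le j.
rewrite mulr_ge0 ?le_max ?lexx ?(ltW r0)//=.
case/orP: ij => [/eqP ij|/andP[/eqP j0 /eqP i1]].
  rewrite -{}ij in br b0 *; apply: (@le_trans _ _ (rho i * (y - x))).
    by rewrite mulrBr; nra.
  by rewrite ler_pM2l// le_max lexx orbT.
apply: (@le_trans _ _ 0); last by rewrite mulr_ge0 ?le_max ?lexx ?(ltW r0).
rewrite subr_le0 j0 i1; move: r0 b0 br separated; rewrite j0 i1.
by move=> *; nra.
Qed.

(** The middle weight is bounded with the factor [rho 1] although its terms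
    vanish; this makes the total rate a convex combination of [rho 0] and
    [rho 1], because [q 0 - p 0 + q 1 = p 1]. *)
Let rate := p 0 * rho 0 + p 1 * rho 1.

Let coupling_ae pi : is_coupling mu nu pi ->
  {ae pi, forall z : V * V, 0 <= (z.1 : R) <= 1 /\ 0 <= (z.2 : R) <= 1}.
Proof.
move=> cpl; have [X [Y [lX lY XE YE]]] := coupling_rv cpl.
have := law_ae_itv01 lY nu_stat.1; have := law_ae_itv01 lX mu_stat.1.
rewrite XE YE.
exact: (@filterS2 _ _ (ae_filter_ringOfSetsType pi)).
Qed.

(** One joint step of the two systems maps couplings to couplings and shrinks
    the order gap. *)
Lemma coupling_step pi : is_coupling mu nu pi ->
  exists2 pi', is_coupling mu nu pi' &
    (order_gap pi' <= rate%:E * order_gap pi)%E.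
Proof.
move=> cpl.
have [pi' pi'E] := exists_mixture pi wt_ge0 wt_sum measurable_pair_map.
have gap0 (z : V * V) : (0 <= (Num.max 0 ((z.2 : R) - (z.1 : R)))%:E)%E.
  by rewrite lee_fin le_max lexx.
exists pi'.
  move=> A mA.
  have mfA i : measurable (affine_pair rho t i @^-1` A : set V).
    by rewrite -[X in measurable X]setTI; exact: measurable_affine_pair.
  have mgA i : measurable (affine_pair beta t i @^-1` A : set V).
    by rewrite -[X in measurable X]setTI; exact: measurable_affine_pair.
  have fE k : pi (pair_map k @^-1` (fst @^-1` A)) =
      mu (affine_pair rho t (idx1 k) @^-1` A).
    exact: (cpl _ (mfA (idx1 k))).1.
  have gE k : pi (pair_map k @^-1` (snd @^-1` A)) =
      nu (affine_pair beta t (idx2 k) @^-1` A).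
    exact: (cpl _ (mgA (idx2 k))).2.
  rewrite !pi'E; split.
    under eq_bigr do rewrite fE.
    rewrite (stationaryE f01 mu_stat mA) sum_ord3 sum_ord2 /wt /idx1 /=.
    congr (_ + _)%E; rewrite -ge0_muleDl ?lee_fin ?subr_ge0//; last first.
      by have [] := q_prob.
    by rewrite -EFinD p1E q1E; congr (_%:E * _)%E; lra.
  under eq_bigr do rewrite gE.
  rewrite (stationaryE g01 nu_stat mA) sum_ord3 sum_ord2 /wt /idx2 /=.
  rewrite addeA; congr (_ + _)%E.
  rewrite -ge0_muleDl ?lee_fin ?subr_ge0//; last by have [] := p_prob.
  by rewrite -EFinD; congr (_%:E * _)%E; lra.
rewrite /order_gap
  (ge0_integral_mixture wt_ge0 measurable_pair_map (fun A _ => pi'E A))//;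
  last exact: measurable_order_gap.
set G := order_gap pi.
have G0 : (0 <= G)%E by apply: integral_ge0 => z _.
have stepG k : (\int[pi]_z (Num.max 0 (((pair_map k z).2 : R) -
    ((pair_map k z).1 : R)))%:E <= (rho (idx1 k))%:E * G)%E.
  have /andP[r0 _] := rho_itv (idx1 k).
  rewrite -ge0_integralZl//; first last.
  - by rewrite lee_fin ltW.
  - exact: measurable_order_gap.
  apply: ae_ge0_le_integral => //.
  - apply/measurable_EFinP; apply: measurable_maxr => //.
    by apply: measurable_funB; apply: measurableT_comp => //;
      exact: measurable_affine_pair.
  - by move=> z _; rewrite mule_ge0// lee_fin ltW.
  - apply: measurable_funeM; exact: measurable_order_gap.
  have := coupling_ae cpl.
  apply: (@filterS _ _ (ae_filter_ringOfSetsType pi)) => z [z1 z2] _.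
  rewrite -EFinM lee_fin; apply: affine_le => //.
  (* The three index pairs are of the two kinds covered by [affine_le]. *)
  by case: k {r0} => [[|[|[|]]]].
apply: (@le_trans _ _ (\sum_(k < 3) (wt k)%:E * ((rho (idx1 k))%:E * G)))%E.
  by apply: lee_sum => k _; rewrite lee_pmul// ?lee_fin// integral_ge0.
under eq_bigr do rewrite muleA -EFinM.
rewrite -ge0_sume_distrl; last first.
  move=> k _; rewrite lee_fin mulr_ge0//.
  by have /andP[/ltW] := rho_itv (idx1 k).
rewrite sumEFin sum_ord3 /wt /idx1 /= /rate p1E q1E.
rewrite le_eqVlt; apply/orP; left; apply/eqP; congr (_%:E * _)%E; ring.
Qed.

Let rate_ge0 : 0 <= rate.
Proof.
have [p0 _] := p_prob.
by rewrite addr_ge0// mulr_ge0//;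
  [case/andP: (rho_itv 0) => /ltW|case/andP: (rho_itv 1) => /ltW].
Qed.

Let rate_lt1 : rate < 1.
Proof.
have [p0] := p_prob; rewrite sum_ord2 => p01.
by apply: convex_comb_lt1 => //;
  [case/andP: (rho_itv 0)|case/andP: (rho_itv 1)].
Qed.

Lemma coupling_iter n : exists2 pi, is_coupling mu nu pi &
  (order_gap pi <= (rate ^+ n)%:E)%E.
Proof.
elim: n => [|n [pi /coupling_step[pi' cpl' step] gap]].
  have cpl := product_is_coupling mu nu.
  exists (mu \x nu)%E => //.
  (* The gap of any coupling is at most 1, since both marginals live on the
     unit interval. *)
  apply: (@le_trans _ _ (\int[(mu \x nu)%E]_(z in setT) (cst 1%E z))%E).
    apply: ae_ge0_le_integral => //.
    - by move=> z _; rewrite lee_fin le_max lexx.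
    - exact: measurable_order_gap.
    have := coupling_ae cpl.
    apply: (@filterS _ _ (ae_filter_ringOfSetsType (mu \x nu)%E)) => z.
    case=> /andP[x0 x1] /andP[y0 y1] _.
    by rewrite lee_fin ge_max ler01; lra.
  rewrite integral_cst// mul1e.
  by rewrite [X in (X <= _)%E](probability_setT (mu \x nu)%E).
exists pi' => //; apply: le_trans step _.
by rewrite exprS EFinM lee_wpmul2l// lee_fin.
Qed.

Lemma exists_coupling_gap_le (e : R) : 0 < e ->
  exists2 pi, is_coupling mu nu pi & (order_gap pi <= e%:E)%E.
Proof.
move=> e0.
have /cvgrPdist_le/(_ e e0)[n _ /(_ n (leqnn n))] :
    (fun n => rate ^+ n) @ \oo --> (0 : R).
  by apply: cvg_expr; rewrite ger0_norm.
rewrite /= sub0r normrN ger0_norm ?exprn_ge0// => le_e.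
have [pi cpl gap] := coupling_iter n.
by exists pi => //; apply: le_trans gap _; rewrite lee_fin.
Qed.

End contraction.

(** * The distance between the two stationary measures *)

(** The order of the right endpoints decides which of two disjoint open
    intervals lies on the left. *)
Lemma affine_images_separated (R : realType) (rho t : 'I_2 -> R) :
  (forall i, 0 < rho i) ->
  Num.max (affine_pair rho t 0 0) (affine_pair rho t 0 1) <=
    Num.max (affine_pair rho t 1 0) (affine_pair rho t 1 1) ->
  (affine_pair rho t 0 @` `]0, 1[%classic) `&`
    (affine_pair rho t 1 @` `]0, 1[%classic) = set0 ->
  rho 0 + t 0 <= t 1.
Proof.
move=> r0; have r00 := r0 0; have r10 := r0 1.
rewrite /affine_pair !mulr0 !add0r !mulr1.
rewrite (max_r (_ : t 0 <= rho 0 + t 0)) ?(max_r (_ : t 1 <= rho 1 + t 1));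
  [|by rewrite lerDr ltW..].
move=> le_right disj.
rewrite leNgt; apply/negP => lt1.
pose lo := Num.max (t 0) (t 1).
have lo0 : t 0 <= lo by rewrite le_max lexx.
have lo1 : t 1 <= lo by rewrite le_max lexx orbT.
have lohi : lo < rho 0 + t 0 by rewrite gt_max lt1 andbT ltrDr.
(* The midpoint of the overlap belongs to both images. *)
pose y := (lo + (rho 0 + t 0)) / 2.
have im i : t i < y < rho i + t i ->
    ((fun x => rho i * x + t i) @` `]0, 1[%classic) y.
  move=> /andP[ty yr]; exists ((y - t i) / rho i).
    rewrite /= in_itv /= divr_gt0 ?subr_gt0//= ltr_pdivrMr// mul1r; lra.
  by rewrite mulrC divfK ?gt_eqF// subrK.
suff : (set0 : set R) y by [].
by rewrite -disj; split; apply: im; rewrite /y; lra.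
Qed.

Theorem corollary2p9 (R : realType) (rho beta t p q : 'I_2 -> R)
  (f g : 'I_2 -> R -> R)
  (hf : f = affine_pair rho t) (hg : g = affine_pair beta t)
  (hrho : forall i, 0 < rho i < 1)
  (hbeta : forall i, 0 < beta i <= rho i)
  (ht : forall i, 0 <= t i < 1)
  (hf01 : forall i, f i @` `[0, 1]%classic `<=` `[0, 1]%classic)
  (hg01 : forall i, g i @` `[0, 1]%classic `<=` `[0, 1]%classic)
  (hmax : Num.max (f 0 0) (f 0 1) <= Num.max (f 1 0) (f 1 1))
  (hdisj : (f 0 @` `]0, 1[%classic) `&` (f 1 @` `]0, 1[%classic) = set0)
  (hp : prob_vector p) (hq : prob_vector q) (hpq : p 0 <= q 0)
  (mu nu : probability (measurableTypeR R) R)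
  (hmu : is_stationary f p mu) (hnu : is_stationary g q nu) :
  W1 mu nu =
    ((\sum_(i < 2) p i * t i) / (1 - \sum_(i < 2) p i * rho i)
     - (\sum_(i < 2) q i * t i) / (1 - \sum_(i < 2) q i * beta i))%:E.
Proof.
subst f g.
have t0 i : 0 <= t i by case/andP: (ht i).
have rho01 i : 0 <= rho i < 1 by have /andP[/ltW -> ->] := hrho i.
have beta01 i : 0 <= beta i < 1.
  have /andP[/ltW -> /=] := hbeta i; move/le_lt_trans; apply.
  by case/andP: (hrho i).
have rho0 i : 0 < rho i by case/andP: (hrho i).
have sep := affine_images_separated rho0 hmax hdisj.
have muE := stationary_mean hp rho01 t0 hf01 hmu.
have nuE := stationary_mean hq beta01 t0 hg01 hnu.
have [mu1 _] := hmu; have [nu1 _] := hnu.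
apply/eqP; rewrite eq_le (W1_ge mu1 nu1 muE nuE) andbT.
apply/lee_addgt0Pr => e e0; have e20 : 0 < e / 2 by rewrite divr_gt0.
have [pi cpl gap] := exists_coupling_gap_le hrho hbeta hf01 hg01 sep
  hp hq hpq hmu hnu e20.
have := W1_le_coupling cpl mu1 nu1; rewrite muE nuE.
move: (_ / (1 - \sum_(i < 2) p i * _)) (_ / (1 - _)) => a b le_gap.
have : (b%:E + W1 mu nu <= a%:E + e%:E)%E.
  apply: le_trans le_gap _; rewrite leeD2l//.
  apply: (@le_trans _ _ (2%:E * (e / 2)%:E)%E); first by rewrite lee_pmul2l.
  by rewrite -EFinM lee_fin mulrC divfK.
case: (W1 mu nu) => [w||] //=; rewrite -?EFinD ?lee_fin; first lra.
by move=> _; rewrite leNye.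
Qed.
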